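(* Let $(V;\rho,\mu,\nu)$ be a representation of a post-Lie algebra $(\mathfrak g,[\cdot,\cdot]_{\mathfrak g},\rhd)$. For $n\ge1$, let $\delta:C_{\mathrm{Der}}^n(\mathfrak g,V)\to C_{\mathrm{Der}}^{n+1}(\mathfrak g,V)$ be defined by $$\begin{aligned}(\delta f)(x_1,\dots,x_{n+1})=&\sum_{i=1}^n(-1)^{i+1}\mu(x_i)f(x_1,\dots,\hat x_i,\dots,x_n,x_{n+1})+\sum_{i=1}^n(-1)^{i+1}\nu(x_{n+1})f(x_1,\dots,\hat x_i,\dots,x_n,x_i)\\&-\sum_{i=1}^n(-1)^{i+1}f(x_1,\dots,\hat x_i,\dots,x_n,x_i\rhd x_{n+1})\\&+\sum_{1\le i<j\le n}(-1)^{i+j}f(x_i\rhd x_j-x_j\rhd x_i+[x_i,x_j]_{\mathfrak g},x_1,\dots,\hat x_i,\dots,\hat x_j,\dots,x_n,x_{n+1}).\end{aligned}$$ Then $\delta\circ\delta=0$.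
   Context: Vector spaces are over a field of characteristic zero. A post-Lie algebra $(\mathfrak g,[\cdot,\cdot]_{\mathfrak g},\rhd)$ is a Lie algebra with a binary product $\rhd$ such that $x\rhd[y,z]_{\mathfrak g}=[x\rhd y,z]_{\mathfrak g}+[y,x\rhd z]_{\mathfrak g}$ and $[x,y]_{\mathfrak g}\rhd z=a_\rhd(x,y,z)-a_\rhd(y,x,z)$, where $a_\rhd(x,y,z)=x\rhd(y\rhd z)-(x\rhd y)\rhd z$. A representation of it on a vector space $V$ is a triple $(\rho,\mu,\nu)$ where $\rho:\mathfrak g\to\mathfrak{gl}(V)$ is a representation of the Lie algebra $(\mathfrak g,[\cdot,\cdot]_{\mathfrak g})$ and $\mu,\nu:\mathfrak g\to\mathfrak{gl}(V)$ are linear maps such that for all $x,y\in\mathfrak g$: $\rho(x\rhd y)=\mu(x)\rho(y)-\rho(y)\mu(x)$; $\nu([x,y]_{\mathfrak g})=\rho(x)\nu(y)-\rho(y)\nu(x)$; $\mu([x,y]_{\mathfrak g})=\mu(x)\mu(y)-\mu(x\rhd y)-\mu(y)\mu(x)+\mu(y\rhd x)$; $\nu(y)\rho(x)=\mu(x)\nu(y)-\nu(y)\mu(x)-\nu(x\rhd y)+\nu(y)\nu(x)$. $\mathrm{Der}(\mathfrak g,V):=\{f\in\mathrm{Hom}(\mathfrak g,V)\mid f([x,y]_{\mathfrak g})=\rho(x)f(y)-\rho(y)f(x)\ \forall x,y\in\mathfrak g\}$. For $n\ge1$, $C_{\mathrm{Der}}^n(\mathfrak g,V)$ is the set of $f\in\mathrm{Hom}(\wedge^{n-1}\mathfrak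 g\otimes\mathfrak g,V)$ such that, for all $x_1,\dots,x_{n-1}\in\mathfrak g$, the map $x\mapsto f(x_1,\dots,x_{n-1},x)$ lies in $\mathrm{Der}(\mathfrak g,V)$. The map $\delta$ does send $C_{\mathrm{Der}}^n(\mathfrak g,V)$ to $C_{\mathrm{Der}}^{n+1}(\mathfrak g,V)$. *)

(* Defs.v *)
From HB Require Import structures.
From mathcomp Require Import all_boot all_order all_algebra.

Set Implicit Arguments.
Unset Strict Implicit.
Unset Printing Implicit Defensive.

Import GRing.Theory.
Local Open Scope ring_scope.

Definition associator (U : zmodType) (op : U -> U -> U) (x y z : U) : U :=
  op x (op y z) - op (op x y) z.

Record postLieAlgebra (K : fieldType) := PostLieAlgebra {
  pl_sort :> lmodType K;
  pl_bracket : {bilinear pl_sort -> pl_sort -> pl_sort};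
  pl_prod : {bilinear pl_sort -> pl_sort -> pl_sort};
  pl_bracketxx : forall x, pl_bracket x x = 0;
  pl_jacobi : forall x y z,
    pl_bracket x (pl_bracket y z) + pl_bracket y (pl_bracket z x)
      + pl_bracket z (pl_bracket x y) = 0;
  pl_prod_bracket : forall x y z,
    pl_prod x (pl_bracket y z)
      = pl_bracket (pl_prod x y) z + pl_bracket y (pl_prod x z);
  pl_bracket_prod : forall x y z,
    pl_prod (pl_bracket x y) z
      = associator pl_prod x y z - associator pl_prod y x z
}.

Notation "[| x , y |]" := (pl_bracket _ x y)
  (at level 0, x at level 99, y at level 99, format "[| x ,  y |]") : ring_scope.
Notation "x |> y" := (pl_prod _ x y)
  (at level 40, left associativity) : ring_scope.

Record postLieRep (K : fieldType) (g : postLieAlgebra K) := PostLieRep {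
  rep_sort :> lmodType K;
  rho : {bilinear g -> rep_sort -> rep_sort};
  mu : {bilinear g -> rep_sort -> rep_sort};
  nu : {bilinear g -> rep_sort -> rep_sort};
  rho_bracket : forall (x y : g) (v : rep_sort),
    rho [| x, y |] v = rho x (rho y v) - rho y (rho x v);
  rho_prod : forall (x y : g) (v : rep_sort),
    rho (x |> y) v = mu x (rho y v) - rho y (mu x v);
  nu_bracket : forall (x y : g) (v : rep_sort),
    nu [| x, y |] v = rho x (nu y v) - rho y (nu x v);
  mu_bracket : forall (x y : g) (v : rep_sort),
    mu [| x, y |] v
      = mu x (mu y v) - mu (x |> y) v - mu y (mu x v) + mu (y |> x) v;
  nu_rho : forall (x y : g) (v : rep_sort),
    nu y (rho x v)
      = mu x (nu y v) - nu y (mu x v) - nu (x |> y) v + nu y (nu x v)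
}.

Arguments rho {K g}.
Arguments mu {K g}.
Arguments nu {K g}.

Section Cochains.
Variables (K : fieldType) (g : postLieAlgebra K) (V : postLieRep g).

Definition is_Der (f : g -> V) : Prop :=
  linear f /\
  forall x y : g, f [| x, y |] = rho V x (f y) - rho V y (f x).

(* Elements of Hom(wedge^m g (x) g, V) are represented, through the universal
   properties of the exterior power and of the tensor product, by maps
   f : g^m -> g -> V.  A cochain of degree n is a map with m = n - 1. *)
Definition cochain (m : nat) : Type := {ffun 'I_m -> g} -> g -> V.

Definition is_hom_wedge_tensor m (f : cochain m) : Prop :=
  [/\ forall (i : 'I_m) (x : {ffun 'I_m -> g}) (y : g),
        linear (fun v : g => f (finfun [eta x with i |-> v]) y),
      forall x : {ffun 'I_m -> g}, linear (f x)
    & forall (x : {ffun 'I_m -> g}) (y : g) (i j : 'I_m),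
        i != j -> x i = x j -> f x y = 0].

(* The space C_Der^(m+1)(g, V). *)
Definition is_CDer m (f : cochain m) : Prop :=
  is_hom_wedge_tensor f /\ forall x : {ffun 'I_m -> g}, is_Der (f x).

Definition omit m (x : {ffun 'I_m.+1 -> g}) (i : 'I_m.+1) : {ffun 'I_m -> g} :=
  [ffun k => x (lift i k)].

(* For i != j, the family (z, x_0, .., ^x_i, .., ^x_j, .., x_m): the sequence
   below then has length m, so the default value of nth is never used. *)
Definition omit2_cons m (z : g) (x : {ffun 'I_m.+1 -> g}) (i j : 'I_m.+1) :
    {ffun 'I_m -> g} :=
  [ffun k : 'I_m =>
     nth z (z :: [seq x l | l <- enum 'I_m.+1 & (l != i) && (l != j)]) k].

(* delta : C_Der^n -> C_Der^(n+1) with n = m + 1; the first n arguments are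
   x 0, .., x m and y is the last one.  Since indices start from 0, the sign
   (-1)^(i+1) of the 1-based formula is (-1) ^+ i, while (-1)^(i+j) is
   unchanged. *)
Definition delta m (f : cochain m) : cochain m.+1 := fun x y =>
  \sum_(i < m.+1) (-1) ^+ i *: mu V (x i) (f (omit x i) y)
  + \sum_(i < m.+1) (-1) ^+ i *: nu V y (f (omit x i) (x i))
  - \sum_(i < m.+1) (-1) ^+ i *: f (omit x i) (x i |> y)
  + \sum_(i < m.+1) \sum_(j < m.+1 | (i < j)%N)
      (-1) ^+ (i + j) *:
        f (omit2_cons (x i |> x j - x j |> x i + [| x i, x j |]) x i j) y.

End Cochains.

(* Main.v *)
Require Import Defs.
From HB Require Import structures.
From mathcomp Require Import all_boot all_order all_algebra.
From mathcomp Require Import boolp functions.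

Set Implicit Arguments.
Unset Strict Implicit.
Unset Printing Implicit Defensive.

Import GRing.Theory.
Local Open Scope ring_scope.

(** The map delta is a Chevalley-Eilenberg differential in disguise.  The bracket
    {x, y} = x |> y - y |> x + [x, y] makes g into another Lie algebra, the
    sub-adjacent one, and x acts on maps phi : g -> V by
    (x . phi)(y) = mu(x) phi(y) + nu(y) phi(x) - phi(x |> y).
    On derivations this is an action of the sub-adjacent Lie algebra
    ([subadj_act_bracket]): in the commutator of the actions of x and y, the
    axiom tying nu to rho turns the terms with mu and nu into
    nu(z) (rho(x) phi(y) - rho(y) phi(x)), which is nu(z) phi([x, y]) exactly
    because phi is a derivation.  Reading a cochain f as an alternating map
    with values in derivations, delta f becomes the usual differential with
    coefficients in this module.

    That the differential d squares to zero is proved without expanding double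
    sums, from Cartan's formula.  Write f_x for f with first argument fixed to x
    and L_x for the Lie derivative.  Cartan's formula (d f)_x = L_x f - d (f_x)
    serves as the recursive definition of d, and two inductions on the number of
    arguments give L_{x,y} = L_x L_y - L_y L_x ([lie_der_br]) and L_x d = d L_x
    ([lie_der_ce_diff]); then
    (d d f)_x = L_x d f - d (L_x f - d (f_x)) = d d (f_x),
    and a third induction concludes ([ce_diff_square]).  The Jacobi identity enters
    in the form {x, {y, z}} = {{x, y}, z} + {y, {x, z}}, and the module law enters
    on the values of f, which are derivations.

    The familiar formula for d, with signs and omitted arguments, agrees with the
    recursive one on skew-symmetric cochains ([ce_diff_skewE]), since the bracket
    {x_i, x_j}, which L_(x_i) inserts in position j, has to be moved to the front.
    As d preserves skew-symmetry ([ce_diff_skew]), this applies to f and to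
    delta f alike. *)

(** * Linear identities in abelian groups *)

(** Formal integer combinations of atoms.  An identity between them holds in every
    abelian group as soon as the coefficients agree, which is decided by
    computation; the tactic [abel] reifies a goal and runs this test. *)
Inductive zterm := ZVar of nat | ZZero | ZOpp of zterm | ZAdd of zterm & zterm.

Fixpoint zterm_eval (M : zmodType) (env : seq M) (e : zterm) : M :=
  match e with
  | ZVar i => env`_i
  | ZZero => 0
  | ZOpp e1 => - zterm_eval env e1
  | ZAdd e1 e2 => zterm_eval env e1 + zterm_eval env e2
  end.

Fixpoint zterm_coef (e : zterm) (i : nat) : int :=
  match e with
  | ZVar j => (i == j)%:Z
  | ZZero => 0
  | ZOpp e1 => - zterm_coef e1 i
  | ZAdd e1 e2 => zterm_coef e1 i + zterm_coef e2 i
  end.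

Lemma zterm_evalE (M : zmodType) (env : seq M) (e : zterm) :
  zterm_eval env e = \sum_(i < size env) env`_i *~ zterm_coef e i.
Proof.
elim: e => [j||e IHe|e1 IH1 e2 IH2] /=.
- have [lt_j|le_j] := ltnP j (size env); last first.
    rewrite nth_default // big1 // => i _.
    by rewrite (ltn_eqF (leq_trans (ltn_ord i) le_j)).
  rewrite (bigD1 (Ordinal lt_j)) //= eqxx big1 ?addr0 // => i.
  by rewrite -val_eqE /= => /negPf ->.
- by rewrite big1.
- by rewrite IHe -sumrN; apply: eq_bigr => i _; rewrite mulrNz.
- by rewrite IH1 IH2 -big_split; apply: eq_bigr => i _; rewrite mulrzDr.
Qed.

Lemma zterm_eqP (M : zmodType) (env : seq M) (e1 e2 : zterm) :
    all (fun i => zterm_coef e1 i == zterm_coef e2 i) (iota 0 (size env)) ->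
  zterm_eval env e1 = zterm_eval env e2.
Proof.
move=> /allP eq_e; rewrite !zterm_evalE; apply: eq_bigr => i _.
by rewrite (eqP (eq_e i _)) // mem_iota ltn_ord.
Qed.

Ltac zterm_index a env :=
  match env with
  | a :: _ => constr:(0%N)
  | _ :: ?env' => let i := zterm_index a env' in constr:(i.+1)
  end.

Ltac zterm_atoms env e :=
  match e with
  | ?a + ?b => let env' := zterm_atoms env a in zterm_atoms env' b
  | - ?a => zterm_atoms env a
  | 0 => env
  | ?a => match env with
          | context [a :: _] => env
          | _ => constr:(a :: env)
          end
  end.

Ltac zterm_reify env e :=
  match e with
  | ?a + ?b => let r := zterm_reify env a in
               let s := zterm_reify env b in constr:(ZAdd r s)
  | - ?a => let r := zterm_reify env a in constr:(ZOpp r)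
  | 0 => constr:(ZZero)
  | ?a => let i := zterm_index a env in constr:(ZVar i)
  end.

Ltac abel :=
  match goal with
  | |- @eq ?M ?l ?r =>
      let env := zterm_atoms (@nil M) l in
      let env := zterm_atoms env r in
      let e1 := zterm_reify env l in
      let e2 := zterm_reify env r in
      apply: (@zterm_eqP _ env e1 e2); vm_compute; exact: isT
  end.

(** * The Chevalley-Eilenberg complex on lists *)

(** Cochains of all degrees at once are functions of lists of arguments, so that
    fixing the first argument of F is the plain function u |-> F (x :: u) and all
    inductions run over the list. *)

Section ListComplex.
Variables (K : pzRingType) (G : zmodType) (W : lmodType K).
Variables (br : G -> G -> G) (act : G -> W -> W).
Hypothesis br_antisym : forall x y, br x y = - br y x.
Hypothesis br_leibniz :
  forall x y z, br x (br y z) = br (br x y) z + br y (br x z).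
Hypothesis actB : forall x, {morph act x : u v / u - v}.

Implicit Types (F : seq G -> W) (s t : seq G).

Definition multiadditive F : Prop := forall s a b t,
  F (s ++ (a - b) :: t) = F (s ++ a :: t) - F (s ++ b :: t).

Definition skew F : Prop := forall s a b t,
  F (s ++ a :: b :: t) = - F (s ++ b :: a :: t).

(** The module law, restricted to the values of F: the action of g on maps g -> V
    satisfies it on derivations, not on all maps. *)
Definition acts_on_values F : Prop := forall x y s,
  act (br x y) (F s) = act x (act y (F s)) - act y (act x (F s)).

(** (L_x F)(y_1, .., y_k) = x . F(y_1, .., y_k) - sum_i F(.., {x, y_i}, ..), with
    the sum peeled off from the left. *)
Fixpoint lie_der x F s : W :=
  if s is y :: t then lie_der x (fun u => F (y :: u)) t - F (br x y :: t)
  else act x (F [::]).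

(** Cartan's formula taken as a definition.  The sign (-1)^i of the explicit
    formula comes from the nested subtractions, and F is only evaluated on lists
    one shorter than s. *)
Fixpoint ce_diff F s : W :=
  if s is x :: t then lie_der x F t - ce_diff (fun u => F (x :: u)) t
  else 0.

Lemma multiadditive_cons F x :
  multiadditive F -> multiadditive (fun u => F (x :: u)).
Proof. by move=> addF s a b t; apply: (addF (x :: s)). Qed.

Lemma skew_cons F x : skew F -> skew (fun u => F (x :: u)).
Proof. by move=> skF s a b t; apply: (skF (x :: s)). Qed.

Lemma acts_on_values_cons F x :
  acts_on_values F -> acts_on_values (fun u => F (x :: u)).
Proof. by move=> repF y z s; apply: repF. Qed.

Lemma multiadditive_opp F s a t :
  multiadditive F -> F (s ++ - a :: t) = - F (s ++ a :: t).
Proof.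
move=> addF; have F0: F (s ++ 0 :: t) = 0 by rewrite -(subrr a) addF subrr.
by rewrite -sub0r addF F0 sub0r.
Qed.

Lemma multiadditive_add F s a b t : multiadditive F ->
  F (s ++ (a + b) :: t) = F (s ++ a :: t) + F (s ++ b :: t).
Proof. by move=> addF; rewrite -{1}[b]opprK addF multiadditive_opp // opprK. Qed.

(** Polarization of F(.., a + b, a + b, ..) = 0. *)
Lemma alternating_skew F : multiadditive F ->
  (forall s a t, F (s ++ a :: a :: t) = 0) -> skew F.
Proof.
move=> addF altF s a b t; apply/eqP; rewrite -addr_eq0; apply/eqP.
have := altF s (a + b) t.
rewrite multiadditive_add // -!(cat_rcons _ s (_ :: t)).
by rewrite !multiadditive_add // !cat_rcons !altF add0r addr0.
Qed.

Lemma act0 x : act x 0 = 0.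
Proof. by have := actB x 0 0; rewrite !subrr. Qed.

Lemma eq_lie_der x F F' s : F =1 F' -> lie_der x F s = lie_der x F' s.
Proof.
by elim: s F F' => [ |y t IH] F F' eqF /=; rewrite ?eqF // (IH _ _ (fun u => eqF _)).
Qed.

(** Agreement is required in a single degree only; this is what makes extension by
    zero outside one degree harmless. *)
Lemma eq_ce_diff F F' s :
    (forall t, (size t).+1 = size s -> F t = F' t) ->
  ce_diff F s = ce_diff F' s.
Proof.
elim: s F F' => [ |x t IH] F F' eqF //=; congr (_ - _).
  elim: t F F' eqF {IH} => [ |y t IH] F F' eqF /=; first by rewrite eqF.
  by rewrite eqF // (IH _ _ (fun u _ => eqF (y :: u) _)) //= => u [->].
by apply: IH => u sz_u; apply: eqF; rewrite /= sz_u.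
Qed.

Lemma lie_derB x F F' s :
  lie_der x (fun u => F u - F' u) s = lie_der x F s - lie_der x F' s.
Proof. by elim: s F F' => [ |y t IH] F F' /=; [apply: actB | rewrite IH; abel]. Qed.

Lemma lie_der0 x s : lie_der x (fun=> 0) s = 0.
Proof. by elim: s => [ |y t IH] /=; rewrite ?act0 // IH subrr. Qed.

Lemma lie_derN x F s : lie_der x (fun u => - F u) s = - lie_der x F s.
Proof.
rewrite -[RHS]sub0r -(lie_der0 x s) -lie_derB.
by apply: eq_lie_der => u; rewrite sub0r.
Qed.

Lemma ce_diffB F F' s :
  ce_diff (fun u => F u - F' u) s = ce_diff F s - ce_diff F' s.
Proof.
elim: s F F' => [ |x t IH] F F' /=; first by rewrite subrr.
by rewrite lie_derB IH; abel.
Qed.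

Lemma ce_diff0 s : ce_diff (fun=> 0) s = 0.
Proof. by elim: s => //= x t ->; rewrite lie_der0 subrr. Qed.

Lemma ce_diffN F s : ce_diff (fun u => - F u) s = - ce_diff F s.
Proof.
rewrite -[RHS]sub0r -(ce_diff0 s) -ce_diffB.
by apply: eq_ce_diff => u _; rewrite sub0r.
Qed.

(** The values contribute the module law, and each argument z contributes the
    Leibniz form of the Jacobi identity for x, y, z. *)
Lemma lie_der_br x y F s : multiadditive F -> acts_on_values F ->
  lie_der (br x y) F s = lie_der x (lie_der y F) s - lie_der y (lie_der x F) s.
Proof.
elim: s F => [ |z t IH] F addF repF /=; first exact: repF.
have repFz := acts_on_values_cons z repF.
rewrite !lie_derB (IH _ (multiadditive_cons z addF) repFz).
have -> : F (br (br x y) z :: t) = F (br x (br y z) :: t) - F (br y (br x z) :: t).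
  by rewrite -(addF [::]) /= (br_leibniz x y z) addrK.
abel.
Qed.

(** With first argument y, the two sides differ by (L_x L_y - L_y L_x - L_{x,y}) F,
    which vanishes, and by the same statement for F with first argument y. *)
Lemma lie_der_ce_diff x F s : multiadditive F -> acts_on_values F ->
  lie_der x (ce_diff F) s = ce_diff (lie_der x F) s.
Proof.
elim: s F => [ |y t IH] F addF repF /=; first exact: act0.
rewrite lie_derB ce_diffB lie_der_br //.
rewrite (IH _ (multiadditive_cons y addF) (acts_on_values_cons y repF)).
abel.
Qed.

Lemma ce_diff_square F s : multiadditive F -> acts_on_values F ->
  ce_diff (ce_diff F) s = 0.
Proof.
elim: s F => [ |x t IH] F addF repF //=.
rewrite ce_diffB lie_der_ce_diff //.
rewrite (IH _ (multiadditive_cons x addF) (acts_on_values_cons x repF)).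
by rewrite subr0 subrr.
Qed.

Lemma lie_der_skew x F : skew F -> skew (lie_der x F).
Proof.
move=> skF s a b t; elim: s F skF => [ |c s IH] F skF /=; last first.
  by rewrite (IH _ (skew_cons c skF)) (skF (_ :: s)) opprB opprK addrC.
rewrite (eq_lie_der _ _ (fun u => skF [::] a b u)) lie_derN /=.
rewrite (skF [::] a (br x b) t) (skF [::] (br x a) b t) /=; abel.
Qed.

(** Exchanging a and b in L_a (F_b) - F({a, b}, ..) - L_b (F_a) + d (F_(a,b))
    changes every term or pair of terms into its opposite. *)
Lemma ce_diff_skew F : multiadditive F -> skew F -> skew (ce_diff F).
Proof.
move=> addF skF s a b t; elim: s F addF skF => [ |c s IH] F addF skF /=; last first.
  rewrite (IH _ (multiadditive_cons c addF) (skew_cons c skF)).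
  by rewrite (lie_der_skew c skF); abel.
rewrite (@eq_ce_diff _ _ t (fun u _ => skF [::] a b u)) ce_diffN /=.
rewrite (br_antisym a b) (multiadditive_opp [::] _ _ addF) /=; abel.
Qed.

Fixpoint remove_at i s : seq G :=
  if s is x :: t then if i is j.+1 then x :: remove_at j t else t else [::].

(** Moving {x, s_k} from position k to the front costs k transpositions. *)
Lemma lie_der_skewE x F s : skew F ->
  lie_der x F s = act x (F s)
    - \sum_(k < size s) (-1) ^+ k *: F (br x s`_k :: remove_at k s).
Proof.
elim: s F => [ |y t IH] F skF /=; first by rewrite big_ord0 subr0.
rewrite (IH _ (skew_cons y skF)) big_ord_recl /= expr0 scale1r opprD.
rewrite [in RHS](eq_bigr (fun k : 'I_(size t) =>
   (-1) ^+ k *: F [:: y, br x t`_k & remove_at k t])); first by rewrite addrA addrAC.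
move=> k _; rewrite /bump /= add0n (skF [::] _ y) scalerN -scaleNr; congr (_ *: _).
by rewrite exprS mulN1r opprK.
Qed.

(** For a list x :: t, the terms i = 0 of both sums make up L_x F, and the terms
    i > 0 make up - d (F_x): the sign of the first sum is the shift of i by
    one, while in the second one i + j shifts by two and the sign comes from
    exchanging x with the bracket in front of it. *)
Lemma ce_diff_skewE F s : skew F ->
  ce_diff F s =
    \sum_(i < size s) (-1) ^+ i *: act s`_i (F (remove_at i s))
  + \sum_(i < size s) \sum_(j < size s | (i < j)%N)
      (-1) ^+ (i + j) *: F (br s`_i s`_j :: remove_at i (remove_at j s)).
Proof.
elim: s F => [ |x t IH] F skF /=; first by rewrite !big_ord0 addr0.
rewrite (IH _ (skew_cons x skF)) lie_der_skewE // !big_ord_recl /=.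
rewrite expr0 scale1r !opprD -!sumrN.
rewrite [X in _ = _ + _ + (X + _)]big_mkcond big_ord_recl /= add0r.
rewrite addrACA; congr (_ + _); first congr (_ + _).
  by apply: eq_bigr => i _; rewrite /= exprS mulN1r scaleNr.
congr (_ + _); first by apply: eq_bigr => k _; rewrite /= exprS mulN1r scaleNr.
apply: eq_bigr => i _; rewrite [in RHS]big_mkcond big_ord_recl /= add0r.
rewrite -big_mkcond -sumrN; apply: eq_bigr => j _ /=.
rewrite (skF [::] _ x) scalerN /bump /= !add1n addnS !exprS.
by rewrite !mulN1r !scaleNr !opprK.
Qed.

End ListComplex.

(** * The sub-adjacent Lie algebra and its action on derivations *)

Section SubAdjacent.
Variables (K : fieldType) (g : postLieAlgebra K) (V : postLieRep g).

(** The bracket in the last sum of [delta]. *)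
Definition subadj_bracket (x y : g) : g := x |> y - y |> x + [| x, y |].

(** The operator collecting the first three sums of [delta]. *)
Definition subadj_act (x : g) (phi : g -> V) : g -> V :=
  fun y => mu V x (phi y) + nu V y (phi x) - phi (x |> y).

Lemma bracket_antisym (x y : g) : [| x, y |] = - [| y, x |].
Proof.
apply/eqP; rewrite -addr_eq0; apply/eqP.
have := pl_bracketxx (x + y).
by rewrite linearDl !linearDr /= !pl_bracketxx add0r addr0.
Qed.

Lemma subadj_bracket_antisym x y : subadj_bracket x y = - subadj_bracket y x.
Proof. by rewrite /subadj_bracket (bracket_antisym x y); abel. Qed.

(** The second post-Lie axiom says that x |-> (x |> _) represents the sub-adjacent
    bracket. *)
Lemma subadj_prod x y z : subadj_bracket x y |> z = x |> (y |> z) - y |> (x |> z).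
Proof.
rewrite /subadj_bracket linearDl linearBl /= pl_bracket_prod /associator.
abel.
Qed.

Lemma subadj_bracket_leibniz x y z :
  subadj_bracket x (subadj_bracket y z) =
  subadj_bracket (subadj_bracket x y) z + subadj_bracket y (subadj_bracket x z).
Proof.
have expand a b c : subadj_bracket a (subadj_bracket b c) =
    a |> (b |> c) - a |> (c |> b) + ([| a |> b, c |] + [| b, a |> c |])
    - (b |> (c |> a) - c |> (b |> a))
    + ([| a, b |> c |] - [| a, c |> b |] + [| a, [| b, c |] |]).
  rewrite {1}/subadj_bracket subadj_prod {1}/subadj_bracket linearDr linearBr /=.
  by rewrite pl_prod_bracket /subadj_bracket linearDr linearBr.
(* Nested brackets go to the second slot, where [expand] applies. *)
rewrite [subadj_bracket (subadj_bracket x y) z]subadj_bracket_antisym !expand.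
have jac : [| x, [| y, z |] |] = [| y, [| x, z |] |] - [| z, [| x, y |] |].
  apply/eqP; rewrite eq_sym subr_eq eq_sym -subr_eq0 -(pl_jacobi x y z).
  by rewrite (bracket_antisym z x) linearNr; apply/eqP; abel.
(* Products go to the second slot as well, so that equal terms become identical. *)
rewrite jac !(bracket_antisym (_ |> _)).
abel.
Qed.

Lemma subadj_actB x : {morph subadj_act x : phi psi / phi - psi}.
Proof.
move=> phi psi; apply/funext => y; rewrite /subadj_act !fctE !linearBr /=; abel.
Qed.

(** The derivation property enters once, to rewrite phi([x, y]) in
    nu(z) phi({x, y}); the result is matched with the terms produced by [nu_rho]. *)
Lemma subadj_act_bracket x y (phi : g -> V) : is_Der phi ->
  subadj_act (subadj_bracket x y) phi =
  subadj_act x (subadj_act y phi) - subadj_act y (subadj_act x phi).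
Proof.
move=> [lin_phi der_phi]; apply/funext => z; rewrite !fctE /subadj_act.
have phiD a b : phi (a + b) = phi a + phi b.
  by have := lin_phi 1 a b; rewrite !scale1r.
have phiB a b : phi (a - b) = phi a - phi b.
  by have := lin_phi (-1) b a; rewrite !scaleN1r ![- _ + _]addrC.
rewrite subadj_prod !phiB !(linearBr, linearDr) /=.
rewrite [phi (subadj_bracket x y)]phiD phiB der_phi.
rewrite [mu V (subadj_bracket x y) _]linearDl linearBl /= mu_bracket.
rewrite !(linearBr, linearDr) /= !nu_rho.
abel.
Qed.

End SubAdjacent.

(** * Cochains as functions of lists *)

Section Cochains.
Variables (K : fieldType) (g : postLieAlgebra K) (V : postLieRep g).

Definition ffun_of_seq m (s : seq g) : {ffun 'I_m -> g} := [ffun k : 'I_m => s`_k].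

(** Extension by zero to the other degrees: multiadditivity and skew-symmetry then
    hold for lists of every size, with no size conditions to carry along. *)
Definition list_cochain m (f : cochain V m) (s : seq g) : g -> V :=
  if size s == m then f (ffun_of_seq m s) else 0.

Lemma ffun_of_seq_codom m (x : {ffun 'I_m -> g}) :
  ffun_of_seq m [seq x i | i <- enum 'I_m] = x.
Proof.
apply/ffunP => i; rewrite ffunE (nth_map i) ?size_enum_ord //.
by rewrite nth_ord_enum.
Qed.

(** The filler 0 gives a base point independent of a, so that the linearity of a
    cochain in one argument, stated through updates, applies to lists. *)
Lemma ffun_of_seq_set m (s : seq g) (a : g) (t : seq g)
    (lt_s : (size s < m)%N) :
  ffun_of_seq m (s ++ a :: t) =
  finfun [eta ffun_of_seq m (s ++ 0 :: t) with Ordinal lt_s |-> a].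
Proof.
apply/ffunP => k; rewrite !ffunE /= -val_eqE /= ffunE !nth_cat.
case: (ltngtP k (size s)) => [//|lt_k|->]; last by rewrite subnn.
by rewrite -(subnSK lt_k).
Qed.

Lemma list_cochain_multiadditive m (f : cochain V m) :
  is_hom_wedge_tensor f -> multiadditive (list_cochain f).
Proof.
move=> [lin_f _ _] s a b t; apply/funext => y.
rewrite /list_cochain !size_cat /= !fctE.
have [sz_m|_] := eqVneq; last by rewrite subr0.
have lt_s : (size s < m)%N by rewrite -sz_m addnS ltnS leq_addr.
rewrite (ffun_of_seq_set (a - b) t lt_s).
rewrite (ffun_of_seq_set a t lt_s) (ffun_of_seq_set b t lt_s).
by rewrite [a - b]addrC -scaleN1r lin_f scaleN1r addrC.
Qed.

Lemma list_cochain_skew m (f : cochain V m) :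
  is_hom_wedge_tensor f -> skew (list_cochain f).
Proof.
move=> hom_f; apply: alternating_skew; first exact: list_cochain_multiadditive.
case: hom_f => _ _ alt_f s a t; apply/funext => y; rewrite /list_cochain.
case: eqP => // sz_m; rewrite size_cat /= in sz_m.
have lt_s : (size s < m)%N by rewrite -sz_m addnS ltnS leq_addr.
have lt_s1 : ((size s).+1 < m)%N by rewrite -sz_m !addnS !ltnS leq_addr.
apply: (alt_f _ y (Ordinal lt_s) (Ordinal lt_s1)).
  by rewrite -val_eqE /= ltn_eqF.
by rewrite !ffunE /= !nth_cat ltnn ltnNge leqnSn subnn subSnn.
Qed.

Lemma list_cochain_acts m (f : cochain V m) : is_CDer f ->
  acts_on_values (@subadj_bracket K g) (@subadj_act K g V) (list_cochain f).
Proof.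
move=> [_ der_f] x y s; apply: subadj_act_bracket.
rewrite /list_cochain; case: eqP => _; first exact: der_f.
by split=> [a u v|a b]; rewrite /= ?linear0r ?subr0 // scaler0 addr0.
Qed.

Lemma map_nth_iotaS (T : Type) (x0 x : T) (s : seq T) (P : pred nat) :
  [seq nth x0 (x :: s) l | l <- iota 1 (size s) & P l] =
  [seq nth x0 s l | l <- iota 0 (size s) & P l.+1].
Proof. by rewrite (iotaDl 1 0) filter_map -map_comp. Qed.

Lemma remove_at_filter (s : seq g) i :
  [seq s`_l | l <- iota 0 (size s) & l != i] = remove_at i s.
Proof.
elim: s i => [ |x t IH] [ |i] //=; rewrite map_nth_iotaS; last by rewrite -IH.
by rewrite filter_predT -[RHS](mkseq_nth 0).
Qed.

Lemma remove_at2_filter (s : seq g) i j : (i < j)%N ->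
  [seq s`_l | l <- iota 0 (size s) & (l != i) && (l != j)] =
  remove_at i (remove_at j s).
Proof.
elim: s i j => [ |x t IH] [ |i] [ |j] //= lt_ij; rewrite map_nth_iotaS.
  by rewrite -remove_at_filter.
by rewrite -IH.
Qed.

Lemma nth_remove_at (s : seq g) i k : (remove_at i s)`_k = s`_(bump i k).
Proof.
elim: s i k => [ |x t IH] [ |i] [ |k] //=; rewrite ?nth_nil //.
by rewrite IH /bump ltnS addnS.
Qed.

Lemma size_remove_at (s : seq g) i :
  (i < size s)%N -> (size (remove_at i s)).+1 = size s.
Proof. by elim: s i => [ |x t IH] [ |i] //= lt_i; rewrite IH. Qed.

Lemma omit_ffun_of_seq m (s : seq g) (i : 'I_m.+1) :
  omit (ffun_of_seq m.+1 s) i = ffun_of_seq m (remove_at i s).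
Proof. by apply/ffunP => k; rewrite !ffunE nth_remove_at. Qed.

Lemma omit2_cons_ffun_of_seq m (s : seq g) (z : g) (i j : 'I_m.+1) :
    (i < j)%N -> size s = m.+1 ->
  omit2_cons z (ffun_of_seq m.+1 s) i j =
  ffun_of_seq m (z :: remove_at i (remove_at j s)).
Proof.
move=> lt_ij sz_s; apply/ffunP => k; rewrite !ffunE.
have -> : [seq ffun_of_seq m.+1 s l | l <- enum 'I_m.+1 & (l != i) && (l != j)] =
    remove_at i (remove_at j s).
  rewrite -remove_at2_filter // sz_s -val_enum_ord.
  rewrite [in RHS]filter_map -[in RHS]map_comp.
  by apply: eq_map => l; rewrite /= ffunE.
apply: set_nth_default.
have lt_j : (j < size s)%N by rewrite sz_s ltn_ord.
have lt_i : (i < size (remove_at j s))%N.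
  by rewrite -ltnS size_remove_at // sz_s (leq_ltn_trans lt_ij).
by rewrite /= size_remove_at // -ltnS size_remove_at // sz_s ltnS.
Qed.

(** Stated for skew-symmetric rather than derivation-valued cochains, so that it
    applies to delta f as directly as to f. *)
Lemma delta_ce_diff m (f : cochain V m) (s : seq g) y :
    skew (list_cochain f) -> size s = m.+1 ->
  delta f (ffun_of_seq m.+1 s) y =
  ce_diff (@subadj_bracket K g) (@subadj_act K g V) (list_cochain f) s y.
Proof.
move=> skew_f sz_s; rewrite ce_diff_skewE // sz_s [RHS]/= !fctE !fct_sumE.
have list_cochainE t : size t = m -> list_cochain f t = f (ffun_of_seq m t).
  by rewrite /list_cochain => ->; rewrite eqxx.
have size_rem (i : 'I_m.+1) : size (remove_at i s) = m.
  by apply: succn_inj; rewrite size_remove_at sz_s.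
rewrite /delta -big_split -sumrB; congr (_ + _); apply: eq_bigr => i _.
  rewrite fctE list_cochainE // /subadj_act omit_ffun_of_seq ffunE.
  by rewrite scalerBr scalerDr.
rewrite fct_sumE; apply: eq_bigr => j lt_ij; rewrite fctE list_cochainE.
  by rewrite !ffunE omit2_cons_ffun_of_seq.
have lt_i : (i < size (remove_at j s))%N.
  by rewrite size_rem (leq_trans lt_ij) // -ltnS.
by rewrite /= size_remove_at.
Qed.

(** On lists of the wrong size both sides vanish, the right one because d raises the
    degree by one. *)
Lemma list_cochain_delta m (f : cochain V m) (s : seq g) :
    is_CDer f ->
  list_cochain (delta f) s =
  ce_diff (@subadj_bracket K g) (@subadj_act K g V) (list_cochain f) s.
Proof.
move=> [hom_f der_f]; rewrite {1}/list_cochain; case: eqP => [sz_s|sz_s].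
  apply/funext => y; apply: delta_ce_diff => //; exact: list_cochain_skew.
have actB := @subadj_actB K g V.
rewrite -[LHS](ce_diff0 (@subadj_bracket K g) actB s).
apply: eq_ce_diff => t sz_t; rewrite /list_cochain; case: eqP => // sz_m.
by rewrite -sz_t sz_m in sz_s.
Qed.

End Cochains.

Theorem theorem4p9 (K : fieldType) (charK0 : [pchar K] =i pred0)
    (g : postLieAlgebra K) (V : postLieRep g) (m : nat) (f : cochain V m)
    (fDer : is_CDer f) (x : {ffun 'I_m.+2 -> g}) (y : g) :
  delta (delta f) x y = 0.
Proof.
have [hom_f _] := fDer.
have addf := list_cochain_multiadditive hom_f.
have skewdf : skew (list_cochain (delta f)).
  move=> s a b t; rewrite !list_cochain_delta //.
  apply: ce_diff_skew => //; last exact: list_cochain_skew.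
    exact: subadj_bracket_antisym.
  exact: subadj_actB.
rewrite -(ffun_of_seq_codom x) delta_ce_diff //; last first.
  by rewrite size_map size_enum_ord.
rewrite (eq_ce_diff _ _ (F' := ce_diff (@subadj_bracket K g) (@subadj_act K g V)
  (list_cochain f))); last by move=> t _; apply: list_cochain_delta.
rewrite ce_diff_square //; last exact: list_cochain_acts.
  exact: subadj_bracket_leibniz.
exact: subadj_actB.
Qed.
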